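(* For sequential transportation games whose distance function is not required to be metric, $\mathrm{SPoS}(U)$, $\mathrm{SPoS}(E)$ and $\mathrm{SPoS}(D)$ are unbounded, even when restricted to games in which all buses have the same permutation. That is, for each $f\in\{U,E,D\}$, if $\mathcal{G}$ is the class of all (not necessarily metric) sequential transportation games in which $\pi_1=\dots=\pi_m$, then $\mathrm{SPoS}(f,\mathcal{G})=+\infty$.
   Context: Transportation game. An instance $\Gamma$ consists of a set of players $N=\{1,\dots,n\}$ ($n\ge 1$), a set of buses $M=\{1,\dots,m\}$ with $m\ge 2$, a complete undirected graph on the vertex set $V=N\cup\{s,t\}$ ($s$ the source, $t$ the destination) with a distance function $d$ assigning a nonnegative real $d(x,y)=d(y,x)$ to each edge (with $d(x,x)=0$), and for each bus $j\in M$ a permutation $\pi_j$ of $N$. The instance is metric if $d(x,w)\le d(x,y)+d(y,w)$ for all $x,y,w\in V$. Distances between distinct vertices may be $0$. An outcome is a map $\sigma:N\to M$, $\sigma_i$ being the bus chosen by player $i$; $\mathcal{P}$ is the set of outcomes. Given $\sigma$, bus $j$ starts at $s$, visits exactly the players $i$ with $\sigma_i=j$, in the order in which they appear in $\pi_j$, and ends at $t$. Let $n_j=|\{i:\sigma_i=j\}|$, let $p^j_i$ be the $i$-th player visited by bus $j$, and put $p^j_{n_j+1}=t$. The cost of the player $p^j_k$ is $c_{p^j_k}(\sigma)=\sum_{l=k}^{n_j} d(p^j_l,p^j_{l+1})$, the distance travelled by her bus from her location to $t$. Social cost functions: $D(\sigma)=\sum_{j=1}^m\sum_{i=1}^{n_j}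 d(p^j_i,p^j_{i+1})$, $E(\sigma)=\max_{i\in N}c_i(\sigma)$, $U(\sigma)=\sum_{i\in N}c_i(\sigma)$. Sequential version. Players choose buses in the order $1,2,\dots,n$, each observing all earlier choices. A strategy of player $i$ is a function $\lambda_i$ assigning a bus to each possible history $\sigma_{<i}=(\sigma_1,\dots,\sigma_{i-1})\in M^{i-1}$; a strategy profile is $\lambda=(\lambda_1,\dots,\lambda_n)$. Its outcome is the $\sigma$ with $\sigma_i=\lambda_i(\sigma_{<i})$ for all $i$. A strategy profile $\lambda$ is a subgame perfect equilibrium (SPE) if for every player $i$ and every history $\sigma_{<i}$, player $i$ cannot decrease her cost by choosing a bus other than $\lambda_i(\sigma_{<i})$ after the history $\sigma_{<i}$, when players $i+1,\dots,n$ then play according to $\lambda_{i+1},\dots,\lambda_n$. An SPE always exists. For a social cost function $f$, $f(\lambda)$ denotes $f$ of the outcome of $\lambda$. With $\sigma^*\in\mathcal{P}$ minimizing $f$, $\mathrm{SPoS}(f,\Gamma)=\min_{\lambda\in \mathrm{SPE}(\Gamma)} f(\lambda)/f(\sigma^* )$, and for a class $\mathcal{G}$ of games $\mathrm{SPoS}(f,\mathcal{G})=\sup_{\Gamma\in\mathcal{G}}\mathrm{SPoS}(f,\Gamma)$, the supremum being over the $\Gamma\in\mathcal{G}$ with $f(\sigma^* )>0$. *)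

(* Defs.v *)
From mathcomp Require Import all_boot all_order all_algebra all_fingroup.
From mathcomp Require Import all_classical reals constructive_ereal ereal.
From mathcomp Require Import zify.

Set Implicit Arguments.
Unset Strict Implicit.
Unset Printing Implicit Defensive.

Import Order.TTheory GRing.Theory Num.Theory.
Local Open Scope classical_set_scope.
Local Open Scope ring_scope.

Inductive vertex (n : nat) : Type :=
  | Source
  | Destination
  | Player of 'I_n.
Arguments Source {n}.
Arguments Destination {n}.

(* The triangle inequality is deliberately not required.                      *)
(* [bus_perm G j k] is the player in position [k] of the permutation of [j].  *)
Record game (R : realType) : Type := Game {
  nplayers : nat;
  nbuses : nat;
  nplayers_gt0 : (0 < nplayers)%N;
  nbuses_gt1 : (1 < nbuses)%N;
  dist : vertex nplayers -> vertex nplayers -> R;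
  dist_ge0 : forall x y, 0 <= dist x y;
  dist_sym : forall x y, dist x y = dist y x;
  distxx : forall x, dist x x = 0;
  bus_perm : 'I_nbuses -> {perm 'I_nplayers}
}.

Section TransportationGame.
Variables (R : realType) (G : game R).

Local Notation n := (nplayers G).
Local Notation m := (nbuses G).

Definition outcome : finType := {ffun 'I_n -> 'I_m}.

Definition bus0 : 'I_m := Ordinal (ltnW (nbuses_gt1 G)).

Definition route (sigma : outcome) (j : 'I_m) : seq 'I_n :=
  [seq i <- [seq bus_perm j k | k <- enum 'I_n] | sigma i == j].

(* With positions counted from 0, [stop sigma j l] is the (l+1)-st stop of    *)
(* bus [j] after the source; past the last player it is the destination.      *)
Definition stop (sigma : outcome) (j : 'I_m) (l : nat) : vertex n :=
  nth Destination [seq Player i | i <- route sigma j] l.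

Definition leg (sigma : outcome) (j : 'I_m) (l : nat) : R :=
  dist (stop sigma j l) (stop sigma j l.+1).

Definition cost (sigma : outcome) (i : 'I_n) : R :=
  let r := route sigma (sigma i) in
  \sum_(index i r <= l < size r) leg sigma (sigma i) l.

(* The leg from the source to the first player is not counted. *)
Definition social_D (sigma : outcome) : R :=
  \sum_(j < m) \sum_(0 <= l < size (route sigma j)) leg sigma j l.

(* The default value 0 is harmless, costs being nonnegative and n positive.   *)
Definition social_E (sigma : outcome) : R :=
  \big[Num.max/0]_(i < n) cost sigma i.

Definition social_U (sigma : outcome) : R := \sum_(i < n) cost sigma i.

(* Players are 0, ..., n-1, so player [i] observes a history of length [i].   *)
Definition profile : Type := forall i : 'I_n, i.-tuple 'I_m -> 'I_m.

Definition history (sigma : outcome) (i : 'I_n) : i.-tuple 'I_m :=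
  [tuple sigma (widen_ord (ltnW (ltn_ord i)) l) | l < i].

Definition step (lam : profile) (sigma : outcome) (i : 'I_n) : outcome :=
  [ffun k => if k == i then lam i (history sigma i) else sigma k].

(* The initial outcome is irrelevant: every coordinate gets overwritten. *)
Definition outcome_of (lam : profile) : outcome :=
  foldl (step lam) [ffun=> bus0] (enum 'I_n).

(* The outcome when [i] chooses [b] after [h] and the later players follow    *)
(* [lam]. The initial value is h_k for k < i and [b] for k >= i; the          *)
(* coordinates k > i are then overwritten one after the other.                *)
Definition continuation (lam : profile) (i : 'I_n) (h : i.-tuple 'I_m)
    (b : 'I_m) : outcome :=
  foldl (step lam) [ffun k : 'I_n => nth b h k]
    [seq k : 'I_n <- enum 'I_n | (i < k)%N].

Definition SPE (lam : profile) : Prop :=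
  forall (i : 'I_n) (h : i.-tuple 'I_m) (b : 'I_m),
    cost (continuation lam h (lam i h)) i <= cost (continuation lam h b) i.

Definition optimum (f : outcome -> R) : outcome :=
  [arg min_(sigma < ([ffun=> bus0] : outcome)) f sigma]%O.

(* The infimum is a minimum, see [SPoS_min] below. *)
Definition SPoS (f : outcome -> R) : R :=
  inf [set f (outcome_of lam) / f (optimum f) | lam in SPE].

End TransportationGame.

Definition social_cost (R : realType) : Type :=
  forall G : game R, outcome G -> R.

Definition SPoS_class (R : realType) (f : social_cost R)
    (C : set (game R)) : \bar R :=
  ereal_sup [set (SPoS (f G))%:E |
             G in C `&` [set G | 0 < f G (optimum (f G))]].

Definition same_permutation (R : realType) (G : game R) : Prop :=
  forall j k : 'I_(nbuses G), bus_perm j = bus_perm k.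

Section Facts.
Variables (R : realType) (G : game R).
Local Notation n := (nplayers G).
Local Notation m := (nbuses G).
Implicit Types (lam : profile G) (sigma : outcome G).

Lemma eq_history (sigma tau : outcome G) (i : 'I_n) :
  (forall k : 'I_n, (k < i)%N -> sigma k = tau k) ->
  history sigma i = history tau i.
Proof. by move=> e; apply: eq_from_tnth => l; rewrite !tnth_mktuple e /=. Qed.

Lemma foldl_step_notin lam sigma (s : seq 'I_n) (k : 'I_n) :
  k \notin s -> foldl (step lam) sigma s k = sigma k.
Proof.
elim: s sigma => //= i s IHs sigma; rewrite inE negb_or => /andP[ki ks].
by rewrite IHs // ffunE (negbTE ki).
Qed.

Lemma foldl_step_in lam sigma (s : seq 'I_n) (k : 'I_n) :
  sorted ltn [seq val i | i <- s] -> k \in s ->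
  foldl (step lam) sigma s k
  = lam k (history (foldl (step lam) sigma s) k).
Proof.
elim: s sigma => //= i s IHs sigma.
move=> sS; have sS' := path_sorted sS.
rewrite inE; have [-> _|ki /= ks] := eqVneq k i; last exact: IHs.
have lts : forall l : 'I_n, l \in s -> (i < l)%N.
  move=> l ls; move: sS; rewrite path_sortedE; last exact: ltn_trans.
  by move=> /andP[/allP aS _]; apply: aS; apply: map_f.
rewrite foldl_step_notin; last by apply/negP => /lts; rewrite ltnn.
rewrite ffunE eqxx; congr (lam i _); apply: eq_history => l li.
rewrite foldl_step_notin; last first.
  by apply/negP => /lts /(ltn_trans li); rewrite ltnn.
by rewrite ffunE ifN //; apply: contraTneq li => ->; rewrite ltnn.
Qed.

Lemma sorted_enum_ord (P : pred 'I_n) :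
  sorted ltn [seq val i | i <- [seq k : 'I_n <- enum 'I_n | P k]].
Proof.
apply: (@subseq_sorted _ _ ltn_trans _ [seq val i | i <- enum 'I_n]).
  by apply: map_subseq; apply: filter_subseq.
by rewrite val_enum_ord iota_ltn_sorted.
Qed.

Lemma outcome_ofE lam (i : 'I_n) :
  outcome_of lam i = lam i (history (outcome_of lam) i).
Proof.
apply: foldl_step_in; last by rewrite mem_enum.
by have := sorted_enum_ord predT; rewrite filter_predT.
Qed.

Lemma continuation_lt lam (i : 'I_n) (h : i.-tuple 'I_m) b (k : 'I_n) :
  (k < i)%N -> continuation lam h b k = nth b h k.
Proof.
move=> ki; rewrite /continuation foldl_step_notin ?ffunE //.
by rewrite mem_filter ltnNge (ltnW ki).
Qed.

Lemma continuation_eq lam (i : 'I_n) (h : i.-tuple 'I_m) b :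
  continuation lam h b i = b.
Proof.
rewrite /continuation foldl_step_notin ?ffunE ?nth_default ?size_tuple //.
by rewrite mem_filter ltnn.
Qed.

Lemma continuation_gt lam (i : 'I_n) (h : i.-tuple 'I_m) b (k : 'I_n) :
  (i < k)%N ->
  continuation lam h b k = lam k (history (continuation lam h b) k).
Proof.
move=> ik; apply: foldl_step_in; first exact: sorted_enum_ord.
by rewrite mem_filter ik mem_enum.
Qed.

Lemma eq_continuation lam lam' (i : 'I_n) (h : i.-tuple 'I_m) b :
  (forall k : 'I_n, (i < k)%N -> lam k = lam' k) ->
  continuation lam h b = continuation lam' h b.
Proof.
move=> e; rewrite /continuation; move: [ffun k : 'I_n => _] => sigma.
have : all (fun k : 'I_n => (i < k)%N) [seq k : 'I_n <- enum 'I_n | (i < k)%N].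
  exact: filter_all.
elim: [seq _ <- _ | _] sigma => //= k s IHs sigma /andP[ik /IHs ->].
by rewrite /step e.
Qed.

Lemma SPE_exists : exists lam, SPE lam.
Proof.
suff H : forall k, (k <= n)%N -> exists lam : profile G,
    forall (i : 'I_n) (h : i.-tuple 'I_m) (b : 'I_m), (n - k <= i)%N ->
    cost (continuation lam h (lam i h)) i <= cost (continuation lam h b) i.
  have [lam lamP] := H n (leqnn n).
  by exists lam => i h b; apply: lamP; rewrite subnn.
elim=> [_|k IHk kn].
  exists (fun _ _ => bus0 G) => i h b; rewrite subn0 leqNgt.
  by rewrite ltn_ord.
have [lam lamP] := IHk (ltnW kn).
pose best (i : 'I_n) (h : i.-tuple 'I_m) :=
  [arg min_(b < bus0 G) cost (continuation lam h b) i]%O.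
pose lam' : profile G := fun i h =>
  if (i == n - k.+1 :> nat)%N then best i h else lam i h.
exists lam' => i h b nki.
have e c : continuation lam' h c = continuation lam h c.
  apply: eq_continuation => l il; apply/funext => g; rewrite /lam' ifN //.
  by apply: contraTneq il => ->; rewrite -leqNgt.
rewrite !e /lam'; case: eqP => [_|/eqP ik].
  by rewrite /best; case: arg_minP => // c _; apply.
by apply: lamP; lia.
Qed.

Lemma SPoS_min (f : outcome G -> R) : exists lam,
  [/\ SPE lam, SPoS f = f (outcome_of lam) / f (optimum f) &
    forall mu, SPE mu -> SPoS f <= f (outcome_of mu) / f (optimum f)].
Proof.
pose g sigma := f sigma / f (optimum f).
have [lam0 lam0P] := SPE_exists.
pose P sigma := `[< exists2 lam, SPE lam & outcome_of lam = sigma >].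
have P0 : P (outcome_of lam0) by apply/asboolP; exists lam0.
case: (@arg_minP _ _ _ (outcome_of lam0) P g P0) => sigma.
move=> /asboolP[lam lamP <-{sigma}] min.
have lamE mu : SPE mu -> g (outcome_of lam) <= g (outcome_of mu).
  by move=> muP; apply: min; apply/asboolP; exists mu.
have E : SPoS f = g (outcome_of lam).
  apply/eqP; rewrite eq_le; apply/andP; split.
    apply: ge_inf; last by exists lam.
    by exists (g (outcome_of lam)) => _ [mu muP <-]; apply: lamE.
  apply: lb_le_inf; first by exists (g (outcome_of lam)), lam.
  by move=> _ [mu muP <-]; apply: lamE.
by exists lam; split=> // mu muP; rewrite E; apply: lamE.
Qed.

End Facts.

(* Main.v *)
Require Import Defs.
From mathcomp Require Import all_boot all_order all_algebra.
From mathcomp Require Import all_classical reals constructive_ereal ereal.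
From mathcomp Require Import perm.

(** Two buses and three players, choosing in the order z, y, x, while both
    buses visit them in the order x, y, z.  The distances are d(x,y) = d(x,z)
    = K, d(y,z) = 2, d(y,t) = 1 and all others are 0.  Player y pays 2 on the
    bus of z and 1 on the other one, whatever x does, so in every subgame
    perfect equilibrium y and z are on different buses; then x meets one of
    them and pays K.  If y joins z and x travels alone, every social cost
    is 2. *)

Set Implicit Arguments.
Unset Strict Implicit.
Unset Printing Implicit Defensive.

Import Order.TTheory GRing.Theory Num.Theory.
Local Open Scope ring_scope.

Section SocialCosts.
Variables (R : realType) (G : game R).
Implicit Types (sigma : outcome G) (i : 'I_(nplayers G)).

Lemma leg_ge0 sigma (j : 'I_(nbuses G)) l : 0 <= leg sigma j l.
Proof. exact: dist_ge0. Qed.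

Lemma cost_ge0 sigma i : 0 <= cost sigma i.
Proof. by apply: sumr_ge0 => l _; exact: leg_ge0. Qed.

Lemma cost_le_U sigma i : cost sigma i <= social_U sigma.
Proof.
rewrite /social_U (bigD1 i) //= lerDl.
by apply: sumr_ge0 => k _; exact: cost_ge0.
Qed.

Lemma cost_le_E sigma i : cost sigma i <= social_E sigma.
Proof. exact: (@le_bigmax _ _ _ 0 (cost sigma)). Qed.

(** The cost of [i] is the tail, from her stop on, of the sum of legs of her own bus; all remaining
    terms are nonnegative. *)
Lemma cost_le_D sigma i : cost sigma i <= social_D sigma.
Proof.
rewrite /social_D (bigD1 (sigma i)) //= -[leLHS]addr0 lerD //; last first.
  by apply: sumr_ge0 => j _; apply: sumr_ge0 => l _; exact: leg_ge0.
rewrite /cost [leRHS](big_cat_nat (n := index i (route sigma (sigma i)))) //=.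
  by rewrite lerDr; apply: sumr_ge0 => l _; exact: leg_ge0.
exact: index_size.
Qed.

Lemma E_le_U sigma : social_E sigma <= social_U sigma.
Proof.
apply/bigmax_leP; split=> [|i _]; last exact: cost_le_U.
by apply: sumr_ge0 => i _; exact: cost_ge0.
Qed.

End SocialCosts.

Section Trap.
Variables (R : realType) (K : R).
Hypothesis K_ge0 : 0 <= K.

(** Each length is stored in one direction only, so that [arc v w + arc w v] is symmetric by
    construction. Player indices follow the choosing order z, y, x; between two players the larger
    index decides the length. *)
Definition arc (v w : vertex 3) : R :=
  match v, w with
  | Player i, Player j => if (j < i)%N then [:: 0; 2; K]`_i else 0
  | Player i, Destination => (i == 1 :> nat)%:R
  | _, _ => 0
  end.

Lemma arc_ge0 v w : 0 <= arc v w.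
Proof.
case: v w => [||[[|[|[|i]]] //= _]] [||j] //=; case: ifP => // _.
Qed.

Lemma trap_dist_ge0 v w : 0 <= arc v w + arc w v.
Proof. by rewrite addr_ge0 ?arc_ge0. Qed.

Lemma trap_dist_sym v w : arc v w + arc w v = arc w v + arc v w.
Proof. exact: addrC. Qed.

Lemma trap_distxx v : arc v v + arc v v = 0.
Proof. by case: v => [||i] /=; rewrite ?ltnn addr0. Qed.

Definition trap : game R :=
  @Game R 3 2 isT isT _ trap_dist_ge0 trap_dist_sym trap_distxx
    (fun=> perm (@rev_ord_inj 3)).

Definition z : 'I_3 := @Ordinal 3 0 isT.
Definition y : 'I_3 := @Ordinal 3 1 isT.
Definition x : 'I_3 := @Ordinal 3 2 isT.

Lemma route_trap (sigma : outcome trap) j :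
  route sigma j = [seq i <- [:: x; y; z] | sigma i == j].
Proof.
have enum3 : enum 'I_(nplayers trap) = [:: z; y; x].
  by apply: (inj_map val_inj); rewrite val_enum_ord.
rewrite /route enum3; congr [seq i <- _ | _].
by rewrite /= !permE; congr [:: _; _; _]; apply: val_inj.
Qed.

(** Since x precedes y on both routes, the choice of x never affects the ride of y to the
    destination. *)
Lemma cost_y (sigma : outcome trap) :
  cost sigma y = if sigma z == sigma y then 2 else 1.
Proof.
rewrite /cost /leg /stop !route_trap /= eqxx.
by do 2 case: ifP => _ /=;
  rewrite /= /index_iota /= unlock /= /dist /= ?(addr0, add0r).
Qed.

Lemma cost_x (sigma : outcome trap) :
  sigma z != sigma y -> K <= cost sigma x.
Proof.
move=> zy; rewrite /cost /leg /stop !route_trap /= eqxx /=.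
have [yx|yx] /= := eqVneq (sigma y) (sigma x).
  rewrite -yx (negbTE zy) /= /index_iota /= unlock /= /dist /=.
  by rewrite !(addr0, add0r) lerDl.
(* Both z and x avoid the bus of y, and there are only two buses. *)
have -> : sigma z == sigma x.
  have two (a b c : 'I_2) : c != b -> b != a -> c == a.
    by case: a b c => [[|[|?]] ?] [[|[|?]] ?] [[|[|?]] ?].
  exact: two zy yx.
by rewrite /= /index_iota /= unlock /= /dist /= !(addr0, add0r).
Qed.

Definition joint : outcome trap :=
  [ffun i : 'I_3 => if i == x then ord_max else ord0 : 'I_2].

Lemma social_U_joint : social_U joint <= 2.
Proof.
rewrite /social_U 3!big_ord_recl big_ord0.
rewrite /cost /leg /stop !route_trap /= !ffunE /=.
rewrite /index_iota /= unlock /= /dist /=.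
by rewrite !(addr0, add0r).
Qed.

Lemma social_D_joint : social_D joint <= 2.
Proof.
rewrite /social_D 2!big_ord_recl big_ord0.
rewrite /leg /stop !route_trap /= !ffunE /=.
rewrite /index_iota /= unlock /= /dist /=.
by rewrite !(addr0, add0r).
Qed.

Lemma SPE_trap_separates (lam : profile trap) :
  SPE lam -> outcome_of lam z != outcome_of lam y.
Proof.
move=> lamP; set sigma := outcome_of lam; apply/eqP => zy.
pose b : 'I_2 := if sigma y == ord0 then ord_max else ord0.
have y_neq_b : (sigma y == b) = false.
  by rewrite /b; case: (sigma y) => [[|[|?]] ?].
(* If y moves to the other bus [b], [cost_y] gives 1 however x replies; the equilibrium condition
   would read 2 <= 1. *)
have := lamP y (history sigma y) b; rewrite -outcome_ofE -/sigma !cost_y.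
rewrite !continuation_eq !continuation_lt //.
have hz c : nth c (history sigma y) z = sigma y.
  rewrite -zy -[LHS](tnth_nth c _ (ord0 : 'I_1)) tnth_mktuple.
  by congr (sigma _); apply: val_inj.
by rewrite !hz eqxx y_neq_b leNgt ltr1n.
Qed.

End Trap.

(** These two bounds are all that the three social costs need to share: the first bounds equilibria
    from below through x, the second bounds the optimum from above. *)
Lemma SPoS_class_eq_pinfty (R : realType) (f : social_cost R) :
  (forall (G : game R) (sigma : outcome G) i, cost sigma i <= f G sigma) ->
  (forall (K : R) (K_ge0 : 0 <= K), f (trap K_ge0) (joint K_ge0) <= 2) ->
  SPoS_class f (@same_permutation R) = +oo%E.
Proof.
move=> cost_f f_joint; apply/eqyP => A A_gt0.
(* With K = 2A and an optimum of at most 2, the ratio is at least A. *)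
have K_ge0 : 0 <= A * 2 by rewrite mulr_ge0 // ltW.
set G := trap K_ge0.
have opt_gt0 : 0 < f G (optimum (f G)).
  by apply: lt_le_trans (cost_f G _ y); rewrite cost_y; case: ifP.
apply: le_ereal_sup_tmp; exists (SPoS (f G))%:E; first by exists G.
rewrite lee_fin; have [lam [lamP -> _]] := SPoS_min (f G).
rewrite ler_pdivlMr //.
apply: (@le_trans _ _ (A * 2)).
  rewrite ler_pM2l //; apply: le_trans (f_joint _ K_ge0).
  by rewrite /optimum; case: arg_minP => // sigma _; apply.
by apply: le_trans (cost_f G _ x); apply: cost_x; exact: SPE_trap_separates.
Qed.

Local Open Scope ereal_scope.

Theorem proposition3p1 (R : realType) :
  [/\ SPoS_class (@social_U R) (@same_permutation R) = +oo,
      SPoS_class (@social_E R) (@same_permutation R) = +oo &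
      SPoS_class (@social_D R) (@same_permutation R) = +oo].
Proof.
split; apply: SPoS_class_eq_pinfty.
- exact: cost_le_U.
- exact: social_U_joint.
- exact: cost_le_E.
- by move=> K K_ge0; apply: le_trans (E_le_U _) (social_U_joint _).
- exact: cost_le_D.
- exact: social_D_joint.
Qed.
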